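(* Let $b\in\{2,3,\dots\}$, $\alpha\in(-1,1)\setminus\{0\}$, let $\phi:\mathbb{R}\to\mathbb{R}$ be Lipschitz continuous, periodic with period $1$ and vanishing on $\mathbb{Z}$, and let $f(t)=\sum_{m=0}^\infty\alpha^m\phi(b^mt)$ for $t\in[0,1]$. Let $(Y_m)_{m\in\mathbb{N}}$ be the stochastic process associated with $\phi$ and $b$ as defined in the context. Then: (a) If $|\alpha|<1/b$, the function $f$ is of bounded variation on $[0,1]$. (b) If $|\alpha|=1/b$, then for all $t\in[0,1]$, $$\lim_{n\uparrow\infty}\sum_{k=0}^{\lfloor tb^n\rfloor}\big|f((k+1)b^{-n})-f(kb^{-n})\big|^p=0\qquad\text{for all } p>1.$$ (c) If $1/b<|\alpha|<1$, let $$Z:=\sum_{m=1}^\infty(\alpha b)^{-m}Y_m .$$ Then $f$ is of bounded variation on $[0,1]$ if and only if $Z=0$ $\mathbb{P}$-a.s. Otherwise, letting $q:=-\log_{|\alpha|}b$, we have for all $t\in(0,1]$ and all $p\ge1$, $$\lim_{n\uparrow\infty}\sum_{k=0}^{\lfloor tb^n\rfloor}\big|f((k+1)b^{-n})-f(kb^{-n})\big|^p=\begin{cases}0&\text{if } p>q,\\ t\cdot\mathbb{E}[|Z|^q]&\text{if } p=q,\\ +\infty&\text{if } p<q.\end{cases}$$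
   Context: $\mathbb{N}=\{1,2,\dots\}$. Every function $f$ defined on $[0,1]$ is extended to $[0,\infty)$ by $f(t):=f(\min\{t,1\})$ (this is only needed when $t=1$ and $k=b^n$ in the sums). Given $\phi$ and $b$, define $$\lambda_{m,k}:=\frac{\phi((k+1)b^{-m})-\phi(kb^{-m})}{b^{-m}},\qquad m\in\mathbb{N},\ k=0,\dots,b^m-1.$$ Let $(\Omega,\mathscr{F},\mathbb{P})$ be a probability space supporting an independent sequence $U_1,U_2,\dots$ of random variables, each uniformly distributed on $\{0,1,\dots,b-1\}$, and define $$R_m:=\sum_{i=1}^mU_ib^{i-1},\qquad Y_m:=\lambda_{m,R_m},\qquad m\in\mathbb{N}.$$ $\mathbb{E}$ denotes expectation with respect to $\mathbb{P}$. *)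

(* Defs.v *)
From HB Require Import structures.
From mathcomp Require Import all_boot all_order all_algebra.
From mathcomp Require Import finmap.
From mathcomp Require Import all_classical all_reals all_analysis.

Set Implicit Arguments.
Unset Strict Implicit.
Unset Printing Implicit Defensive.

Import Order.TTheory GRing.Theory Num.Theory.
Import numFieldNormedType.Exports.

Local Open Scope classical_set_scope.
Local Open Scope ring_scope.

Section functions.
Context {R : realType}.

Definition log_base (a x : R) : R := ln x / ln a.

Definition fractal_fun (b : nat) (alpha : R) (phi : R -> R) (t : R) : R :=
  \big[+%R/0]_(0 <= m <oo) (alpha ^+ m * phi (b%:R ^+ m * t)).

(* f : [0,1] -> R extended to [0,oo) by f(t) := f(min(t,1)) *)
Definition extend1 (f : R -> R) (t : R) : R := f (Num.min t 1).

(* For 0 <= x, [Num.truncn x] is the floor of x as a natural number; the upper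
   bound of the big operator is exclusive, whence the successor. *)
Definition power_variation (b : nat) (f : R -> R) (p t : R) (n : nat) : R :=
  \sum_(0 <= k < (Num.truncn (t * b%:R ^+ n)).+1)
    `| extend1 f (k.+1%:R * b%:R ^- n) - extend1 f (k%:R * b%:R ^- n) | `^ p.

Definition slope (b : nat) (phi : R -> R) (m k : nat) : R :=
  (phi (k.+1%:R * b%:R ^- m) - phi (k%:R * b%:R ^- m)) / b%:R ^- m.

End functions.

Section random_variables.
Context {R : realType} {d : measure_display} {Omega : measurableType d}.
Variable P : probability Omega R.

Definition mutually_independent {d' : measure_display}
    {T : measurableType d'} {I : choiceType} (X : I -> {RV P >-> T}) : Prop :=
  forall (J : {fset I}) (A : I -> set T),
    (forall i, i \in J -> measurable (A i)) ->
    P (\bigcap_(i in [set` J]) (X i @^-1` A i)) =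
    (\prod_(i <- J) P (X i @^-1` A i))%E.

Definition uniform_digit (b : nat) (X : {RV P >-> nat}) : Prop :=
  forall k : nat, (k < b)%N -> P (X @^-1` [set k]) = (b%:R^-1)%:E.

(* The sequence of digits is indexed from 0: [U i] stands for U_{i+1}, so that
   R_m = U_1 + U_2 b + ... + U_m b^(m-1). *)
Definition Rproc (b : nat) (U : nat -> {RV P >-> nat}) (m : nat) (w : Omega)
    : nat :=
  (\sum_(0 <= i < m) U i w * b ^ i)%N.

Definition Yproc (b : nat) (phi : R -> R) (U : nat -> {RV P >-> nat}) (m : nat)
    (w : Omega) : R :=
  slope b phi m (Rproc b U m w).

Definition Zvar (b : nat) (alpha : R) (phi : R -> R)
    (U : nat -> {RV P >-> nat}) (w : Omega) : R :=
  \big[+%R/0]_(1 <= m <oo) ((alpha * b%:R) ^- m * Yproc b phi U m w).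

End random_variables.

(* Main.v *)
(* On the b-adic grid the series for f is finite, and
     f((k+1) b^-n) - f(k b^-n) = alpha^n z_n(k),
     z_n(k) = sum_{1 <= m <= n} (alpha b)^-m lambda_{m,k},
   where z_n(k) depends only on k mod b^n and Z_n := z_n(R_n) tends to Z.
   If 1/b < |alpha|, the truncation z_m(k), a b^m-periodic function of k,
   approximates every z_n(k) with n >= m up to O(|alpha b|^-m); hence the averages
   of |z_n(k)|^p over k <= t b^n tend to t E|Z|^p, and the p-variation is
   (b |alpha|^p)^n times such an average, with b |alpha|^q = 1.  If Z = 0 a.s.,
   the same tail bound gives z_n(k) = O(|alpha b|^-n), because R_n takes every
   value with positive probability: the increments of f on the grid are O(b^-n),
   so that f is Lipschitz. *)
Require Import Defs.
From HB Require Import structures.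
From mathcomp Require Import all_boot all_order all_algebra.
From mathcomp Require Import finmap.
From mathcomp Require Import all_classical all_reals all_analysis.
From mathcomp Require Import measurable_realfun ring lra.

Set Implicit Arguments.
Unset Strict Implicit.
Unset Printing Implicit Defensive.

Import Order.TTheory GRing.Theory Num.Theory.
Import numFieldNormedType.Exports.

Local Open Scope classical_set_scope.
Local Open Scope ring_scope.

(** * Estimates for sequences, real powers and bounded variation *)

Section real_lemmas.
Context {R : realType}.
Implicit Types (u e : R^nat) (v : nat -> R).

(** A bound on [u n - u m] that is uniform in [n] gives the Cauchy property and, letting [n] tend to
    infinity, the error bound for the limit. It serves both the series for f and the series for
    Z. *)
Lemma cvg_bound_tail u e :
  (forall m n, (m <= n)%N -> `|u n - u m| <= e m) -> e @ \oo --> (0 : R) ->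
  cvgn u /\ forall m, `|limn u - u m| <= e m.
Proof.
move=> ue e0.
have cu : cvgn u.
  apply/cauchy_cvgP/cauchy_exP => eps eps0.
  have /cvgrPdist_lt /(_ _ eps0) [N _ /= hN] := e0.
  exists (u N); exists N => //= n /= Nn.
  rewrite /ball/= distrC (le_lt_trans (ue _ _ Nn))//.
  rewrite (le_lt_trans (ler_norm _))//.
  by have := hN N (leqnn _); rewrite sub0r normrN.
split=> // m.
have cd : (`|u n - u m| @[n --> \oo]) --> `|limn u - u m|.
  by apply: cvg_norm; apply: cvgB => //; exact: cvg_cst.
rewrite -(cvg_lim _ cd)//; apply: limr_le; first by apply/cvg_ex; eexists; exact: cd.
by exists m => // n /= mn; exact: ue.
Qed.

Lemma geometric_sum_tail (L rho : R) v : 0 <= rho < 1 ->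
  (forall k, `|v k| <= L * rho ^+ k) ->
  forall m n, (m <= n)%N ->
  `|\sum_(m <= k < n) v k| <= L / (1 - rho) * rho ^+ m.
Proof.
move=> /andP[r0 r1] hv m n mn.
have L0 : 0 <= L by have := le_trans (normr_ge0 _) (hv 0%N); rewrite expr0 mulr1.
(* The sharper factor [rho ^+ m - rho ^+ n] telescopes, so the induction on [n] goes through. *)
suff h : `|\sum_(m <= k < n) v k| <= L / (1 - rho) * (rho ^+ m - rho ^+ n).
  rewrite (le_trans h)// ler_wpM2l ?divr_ge0 ?subr_ge0 ?(ltW r1)//.
  by rewrite gerBl exprn_ge0.
elim: n mn => [|n ih].
  by rewrite leqn0 => /eqP ->; rewrite big_geq// normr0 subrr mulr0.
rewrite leq_eqVlt => /predU1P[->|]; first by rewrite big_geq// normr0 subrr mulr0.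
rewrite ltnS => mn; rewrite big_nat_recr//= (le_trans (ler_normD _ _))//.
have -> : L / (1 - rho) * (rho ^+ m - rho ^+ n.+1) =
          L / (1 - rho) * (rho ^+ m - rho ^+ n) + L * rho ^+ n.
  by rewrite exprS; field; rewrite subr_eq0 gt_eqF.
by rewrite lerD// ih.
Qed.

Lemma cvg_geometric0 (a r : R) : `|r| < 1 -> (a * r ^+ n @[n --> \oo]) --> (0 : R).
Proof. by move=> r1; exact: cvg_geometric. Qed.

Lemma cvg_expr_pinfty (a r : R) : 0 < a -> 1 < r ->
  (a * r ^+ n @[n --> \oo]) --> +oo.
Proof.
move=> a0 r1.
apply/cvgryPge => A.
have : (a^-1 * (r^-1) ^+ n @[n --> \oo]) --> (0 : R).
  apply: cvg_geometric0; rewrite ger0_norm ?invr_ge0; last lra.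
  by rewrite invf_lt1//; lra.
move=> /cvgrPdist_lt /(_ (Num.max A 1)^-1).
rewrite invr_gt0 lt_max ltr01 orbT => /(_ isT).
apply: filterS => n /=; rewrite sub0r normrN gtr0_norm; last first.
  by rewrite mulr_gt0// ?exprn_gt0// invr_gt0//; lra.
rewrite exprVn -invfM ltf_pV2 ?posrE ?mulr_gt0 ?exprn_gt0//;
  [|lra|by rewrite lt_max ltr01 orbT].
by rewrite gt_max => /andP[/ltW].
Qed.

(** Mean value theorem: since p >= 1, the derivative p z^(p-1) is at most p K^(p-1) on [0, K]. *)
Lemma powR_lipschitz (p K x y : R) : 1 <= p -> 0 <= x <= K -> 0 <= y <= K ->
  `|x `^ p - y `^ p| <= p * K `^ (p - 1) * `|x - y|.
Proof.
move=> p1; wlog xy : x y / y <= x => [hw hx hy|/andP[x0 xK] /andP[y0 _]].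
  case: (leP y x) => [yx|/ltW xy]; first exact: hw.
  by rewrite distrC (distrC x) hw.
have pK : x `^ (p - 1) <= K `^ (p - 1).
  by apply: ge0_ler_powR; rewrite ?nnegrE ?subr_ge0//; exact: le_trans xK.
have pp : 0 <= p by lra.
rewrite !ger0_norm ?subr_ge0//; last by rewrite ge0_ler_powR ?nnegrE.
(* The derivative is used at positive points only, so y = 0 is settled apart, through x^p = x^(p-1)
   x. *)
have [y00|y1] := eqVneq y 0.
  rewrite y00 powR0 ?subr0; last by rewrite gt_eqF//; lra.
  have [->|xn0] := eqVneq x 0; first by rewrite powR0 ?mulr0// gt_eqF//; lra.
  have -> : x `^ p = x `^ (p - 1) * x.
    rewrite -[X in _ = _ * X]powRr1// -powRD ?subrK//.
    by apply/implyP.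
  rewrite ler_pM2r ?lt_def ?xn0// (le_trans pK)//.
  by rewrite ler_peMl// powR_ge0.
have yp : 0 < y by rewrite lt_def y1.
have [||c cI ->] := @MVT_segment R (fun z => z `^ p) (fun z => p * z `^ (p - 1)) y x xy.
- move=> z; rewrite in_itv/= => /andP[yz _].
  by apply: is_derive1_powR; exact: lt_trans yz.
- apply: derivable_within_continuous => z; rewrite in_itv/= => /andP[yz _].
  by apply: derivable_powR; rewrite in_itv/= andbT (lt_le_trans yp).
rewrite ler_wpM2r ?subr_ge0// ler_wpM2l// (le_trans _ pK)//.
move: cI; rewrite in_itv/= => /andP[yc cx].
by rewrite ge0_ler_powR ?nnegrE ?subr_ge0// ltW// (lt_le_trans yp).
Qed.

(** On every partition the variation of [f] is at most that of the monotone map x -> K x, which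
    telescopes to K b - K a. *)
Lemma klipschitz_bounded_variation (a b K : R) (f : R -> R) : 0 <= K -> a <= b ->
  (forall x y, a <= x <= b -> a <= y <= b -> `|f x - f y| <= K * `|x - y|) ->
  bounded_variation a b f.
Proof.
move=> K0 ab fK; exists (K * b - K * a) => _ [s abs <-].
rewrite -(@nondecreasing_variation _ a b ( *%R K) s)//; last first.
  by move=> x y _ _ xy; exact: ler_wpM2l.
rewrite /variation; apply: ler_sum_nat => i /andP[_ si].
have h j : (j <= size s)%N -> a <= nth b (a :: s) j <= b.
  by move=> js; rewrite itv_partition_nth_ge// itv_partition_nth_le.
rewrite /= -mulrBr normrM (ger0_norm K0).
apply: fK; [exact: (h i.+1)|exact/(h i)/ltnW].
Qed.

End real_lemmas.

Lemma cvg_expr_powR_natmul (R : realType) (r p C : R) : 0 < r < 1 -> 0 < p -> 0 <= C ->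
  (r ^+ n * (C * n%:R) `^ p @[n --> \oo]) --> (0 : R).
Proof.
move=> /andP[r0 r1] p0 C0.
(* [r ^+ n = (s ^+ n * s ^+ n) `^ p], and [n * s ^+ n] is bounded. *)
pose s := r `^ (2 * p)^-1; pose v := Num.sqrt r.
have s0 : 0 < s by rewrite powR_gt0.
have p2 : 0 < (2 * p)^-1 by rewrite invr_gt0 mulr_gt0.
have s1 : s < 1.
  have -> : 1 = 1 `^ (2 * p)^-1 by rewrite powR1.
  by rewrite gt0_ltr_powR ?nnegrE// ltW.
have sv : s `^ p = v.
  rewrite /s -powRrM (_ : _ * p = 2^-1); first by rewrite powR12_sqrt// ltW.
  by field; rewrite gt_eqF.
(* Powers of [s] decrease, so n s^n is at most the sum of s^i over i < n, a partial geometric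
   sum. *)
have ns n : n%:R * s ^+ n <= (1 - s)^-1.
  have h k : `|s ^+ k| <= 1 * s ^+ k by rewrite mul1r ger0_norm// exprn_ge0// ltW.
  have := @geometric_sum_tail _ 1 s _ _ h 0%N n (leq0n n).
  rewrite (ltW s0) s1 expr0 mulr1 div1r => /(_ isT); apply: le_trans.
  rewrite (le_trans _ (ler_norm _))// mulrC mulr_natr -[X in _ *+ X]subn0 -sumr_const_nat.
  rewrite !big_nat; apply: ler_sum => i /andP[_ iN].
  by apply: ler_wiXn2l; [exact: ltW|exact: ltW|exact: ltnW].
have v0 : 0 <= v by exact: sqrtr_ge0.
have v1 : v < 1 by rewrite -sqrtr1 ltr_sqrt.
have h : (((C / (1 - s)) `^ p) * v ^+ n @[n --> \oo]) --> (0 : R).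
  by apply: cvg_geometric0; rewrite ger0_norm.
apply: (squeeze_cvgr _ (cvg_cst 0) h); near=> n.
rewrite mulr_ge0 ?exprn_ge0 ?powR_ge0 ?(ltW r0)//=.
have -> : r ^+ n = v ^+ n * v ^+ n by rewrite -exprMn -expr2 sqr_sqrtr// ltW.
rewrite -mulrA mulrC ler_wpM2r ?exprn_ge0//.
have -> : v ^+ n = (s ^+ n) `^ p.
  by rewrite -sv -[s ^+ n]powR_mulrn ?(ltW s0)// -powRrM mulrC powRrM powR_mulrn ?powR_ge0.
rewrite -powRM ?exprn_ge0 ?mulr_ge0 ?(ltW s0)//.
apply: ge0_ler_powR; rewrite ?nnegrE ?mulr_ge0 ?exprn_ge0 ?invr_ge0 ?subr_ge0
  ?(ltW s0) ?(ltW s1) ?(ltW p0)//.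
by rewrite mulrCA ler_wpM2l// mulrC.
Unshelve. all: by end_near. Qed.

Lemma cvg_EFin_real (R : realType) (u : R^nat) (l : R) :
  u @ \oo --> l -> ((u n)%:E @[n --> \oo]) --> l%:E.
Proof. by move=> ul; apply: cvg_EFin => //; exact: nearW. Qed.

(** The points k b^-n with 0 <= k <= b^n partition [0, 1]. With p = 1 this lets divergence along the
    grids refute bounded variation. *)
Lemma grid_variation_le (R : realType) (b : nat) (f : R -> R) (M : R) n : (0 < b)%N ->
  (forall v, variations 0 1 f v -> v <= M) -> power_variation b f 1 1 n <= M.
Proof.
move=> b0 hM.
have bn0 : 0 < b%:R ^+ n :> R by rewrite exprn_gt0// ltr0n.
pose F k := f (k%:R * b%:R ^- n).
pose s := mkseq (fun k => k.+1%:R * b%:R ^- n : R) (b ^ n).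
have ss : size s = (b ^ n)%N by rewrite size_mkseq.
have nths k : (k <= b ^ n)%N -> nth 1 (0 :: s) k = k%:R * b%:R ^- n.
  by case: k => [|k] kb; rewrite ?mul0r//= nth_mkseq.
have part : itv_partition 0 1 s.
  split; last first.
    rewrite -[last 0 s]/(last 1 (0 :: s)) -nth_last -[size _]/(size s).+1 ss nths//.
    by rewrite natrX divff// gt_eqF.
  apply/(pathP 1) => i; rewrite ss => ib.
  rewrite -[nth 1 s i]/(nth 1 (0 :: s) i.+1) !nths ?(ltnW ib)//.
  by rewrite ltr_pM2r ?invr_gt0// ltr_nat.
have := hM _ (variations_variation f part); apply: le_trans.
have grid1 k : (b ^ n <= k)%N -> Num.min (k%:R * b%:R ^- n) 1 = 1 :> R.
  by move=> kb; rewrite min_r// ler_pdivlMr// mul1r -natrX ler_nat.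
(* The last index k = b^n contributes nothing: [extend1] cuts both of its points off at 1. *)
have -> : power_variation b f 1 1 n =
    \sum_(0 <= k < b ^ n) `|extend1 f (k.+1%:R * b%:R ^- n) - extend1 f (k%:R * b%:R ^- n)|.
  rewrite /power_variation mul1r -[in Num.truncn _]natrX natrK big_nat_recr//=.
  rewrite /extend1 [X in _ + X](_ : _ = 0) ?addr0.
    by apply: eq_bigr => k _; rewrite powRr1.
  by rewrite !grid1 ?leqnSn// subrr normr0 powR0 ?oner_eq0.
rewrite /variation ss !big_nat; apply: ler_sum => i /andP[_ ib].
rewrite [leRHS](_ : _ = `|f (i.+1%:R * b%:R ^- n) - f (i%:R * b%:R ^- n)|); last first.
  by congr (`|f _ - f _|); [exact: (nths i.+1)|exact: (nths i (ltnW ib))].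
rewrite /extend1 !min_l// ler_pdivrMr// mul1r -natrX ler_nat//.
exact: ltnW.
Qed.

(** * The slopes of phi and the sums z_n(k) *)

Section self_affine.
Context {R : realType}.
Variables (b : nat) (phi : R -> R) (L : R).
Hypothesis hb : (2 <= b)%N.
Hypothesis phiL : forall x y, `|phi x - phi y| <= L * `|x - y|.
Hypothesis phi_per : periodic phi 1.
Hypothesis phi_int : forall z : int, phi z%:~R = 0.

Let b_gt0 : 0 < b%:R :> R. Proof. by rewrite ltr0n (leq_trans _ hb). Qed.
Let b_neq0 : b%:R != 0 :> R. Proof. by rewrite gt_eqF. Qed.
Let bn_gt0 n : 0 < b%:R ^+ n :> R. Proof. by rewrite exprn_gt0. Qed.
Let L_ge0 : 0 <= L.
Proof. by have := le_trans (normr_ge0 _) (phiL 1 0); rewrite subr0 normr1 mulr1. Qed.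

Lemma phi_nat (k : nat) : phi k%:R = 0.
Proof. exact: (phi_int k). Qed.

(** The floor of [x] is a zero of [phi] at distance at most 1. *)
Lemma phi_bounded x : `|phi x| <= L.
Proof.
have := phiL x (Num.floor x)%:~R; rewrite phi_int subr0 => /le_trans; apply.
rewrite ler_piMr// ger0_norm ?subr_ge0 ?floor_le// lerBlDr addrC.
by rewrite -intrD1 ltW// floorD1_gt.
Qed.

Lemma slope_bounded m k : `|slope b phi m k| <= L.
Proof.
rewrite /slope normrM normfV (gtr0_norm (x := b%:R ^- m)) ?invr_gt0//.
rewrite ler_pdivrMr ?invr_gt0// (le_trans (phiL _ _))//.
by rewrite -mulrBl -natrB// subSnn mul1r gtr0_norm ?invr_gt0.
Qed.

(** As m <= n, changing [k] by a multiple of b^n moves k b^-m by an integer, which is a multiple of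
    the period of [phi]. *)
Lemma slope_modn m n k : (m <= n)%N -> slope b phi m (k %% b ^ n) = slope b phi m k.
Proof.
move=> mn; rewrite {2}(divn_eq k (b ^ n)).
have h q j : phi ((q * b ^ n + j)%:R * b%:R ^- m) = phi (j%:R * b%:R ^- m).
  rewrite -(subnK mn) expnD mulnA natrD natrM natrX mulrDl mulfK ?gt_eqF//.
  by rewrite addrC (periodicn phi_per).
by rewrite /slope -addnS !h.
Qed.

(** For [c = alpha * b%:R] this is z_n(k). *)
Definition zsum (c : R) n k := \sum_(1 <= m < n.+1) c ^- m * slope b phi m k.

Lemma zsum_modn c m n k : (m <= n)%N -> zsum c m (k %% b ^ n) = zsum c m k.
Proof.
move=> mn; apply: eq_big_nat => i /andP[_ im].
by rewrite slope_modn// (leq_trans _ mn).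
Qed.

(** In the critical case (b) the weights do not decay; linear growth in [n] is still slow enough
    against a geometric factor. *)
Lemma zsum_le_nat c n k : `|c| = 1 -> `|zsum c n k| <= L * n%:R.
Proof.
move=> c1; rewrite (le_trans (ler_norm_sum _ _ _))//.
rewrite (@le_trans _ _ (\sum_(1 <= m < n.+1) L))//; last first.
  by rewrite sumr_const_nat subn1 mulr_natr.
apply: ler_sum => m _.
by rewrite normrM normfV normrX c1 expr1n invr1 mul1r slope_bounded.
Qed.

Lemma zterm_bounded c m k : `|c ^- m * slope b phi m k| <= L * (`|c|^-1) ^+ m.
Proof.
by rewrite normrM normfV normrX exprVn mulrC ler_wpM2r ?slope_bounded// invr_ge0 exprn_ge0.
Qed.

Let tail_cst (c : R) := L / (1 - `|c|^-1).

Lemma zsum_tail c m n k : 1 < `|c| -> (m <= n)%N ->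
  `|zsum c n k - zsum c m k| <= tail_cst c * (`|c|^-1) ^+ m.
Proof.
move=> c1 mn; rewrite /zsum (big_cat_nat (n := m.+1))//= addrAC subrr add0r.
have c0 : 0 < `|c| by rewrite (lt_trans ltr01).
have ci : 0 <= `|c|^-1 < 1 by rewrite invr_ge0 (ltW c0) invf_lt1.
have := geometric_sum_tail ci (fun i => zterm_bounded c i k) (mn : (m.+1 <= n.+1)%N).
move=> /le_trans; apply; rewrite ler_wpM2l//.
  by rewrite divr_ge0// subr_ge0 ltW//; case/andP: ci.
(* The tail starts at index m + 1; the spare factor |c|^-1 <= 1 is given away. *)
by rewrite exprS ler_piMl ?exprn_ge0 ?invr_ge0//; case/andP: ci => _ /ltW.
Qed.

Lemma zsum_bounded c n k : 1 < `|c| -> `|zsum c n k| <= tail_cst c.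
Proof.
move=> c1; have := zsum_tail k c1 (leq0n n).
by rewrite expr0 mulr1 {2}/zsum big_geq// subr0.
Qed.

(** * The function f on the b-adic grid, and its continuity *)

Section fractal.
Variable alpha : R.
Hypothesis alpha_lt1 : `|alpha| < 1.
Hypothesis alpha_neq0 : alpha != 0.

Let f := fractal_fun b alpha phi.

Let psum n t := \sum_(0 <= m < n) alpha ^+ m * phi (b%:R ^+ m * t).

Let psum_tail m n t : (m <= n)%N ->
  `|psum n t - psum m t| <= L / (1 - `|alpha|) * `|alpha| ^+ m.
Proof.
move=> mn; rewrite /psum (big_cat_nat (n := m))//= addrAC subrr add0r.
apply: geometric_sum_tail => //; first by rewrite normr_ge0.
by move=> k; rewrite normrM normrX mulrC ler_wpM2r// phi_bounded.
Qed.

Let psum_cvg t : cvgn (psum ^~ t) /\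
  forall m, `|f t - psum m t| <= L / (1 - `|alpha|) * `|alpha| ^+ m.
Proof.
apply: cvg_bound_tail => [m n|]; first exact: psum_tail.
by apply: cvg_geometric0; rewrite normr_id.
Qed.

(** For m >= n the argument b^m k b^-n is an integer, where [phi] vanishes, so the partial sums are
    constant from [n] on. *)
Lemma fractal_grid n k : f (k%:R * b%:R ^- n) = psum n (k%:R * b%:R ^- n).
Proof.
rewrite /f /fractal_fun.
apply: (@lim_near_cst _ _ _ _ eventually_filter) => //.
exists n => // N /= nN; rewrite (big_cat_nat (n := n))//=.
rewrite [X in _ + X]big_nat_cond [X in _ + X]big1 ?addr0//.
move=> m; rewrite andbT => /andP[nm _].
rewrite -(subnK nm) [_ * (k%:R / _)]mulrCA (exprD b%:R) mulfK ?expf_neq0//.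
by rewrite -natrX -natrM phi_nat mulr0.
Qed.

(** Reversing the summation turns m into n - m. Then b^(n-m) k b^-n = k b^-m, so the difference of
    [phi] is b^-m times a slope, and alpha^(n-m) b^-m = alpha^n (alpha b)^-m. *)
Lemma fractal_increment n k :
  f (k.+1%:R * b%:R ^- n) - f (k%:R * b%:R ^- n) =
  alpha ^+ n * zsum (alpha * b%:R) n k.
Proof.
rewrite !fractal_grid /psum -sumrB big_nat_rev/= add0n /zsum big_add1/=.
rewrite mulr_sumr; apply: eq_big_nat => m /andP[_ mn].
rewrite -mulrBr /slope.
have h (j : nat) : b%:R ^+ (n - m.+1) * (j%:R * b%:R ^- n) = j%:R * b%:R ^- m.+1 :> R.
  rewrite mulrCA; congr (_ * _); rewrite -[in b%:R ^- n](subnK mn) exprD invfM mulrA.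
  by rewrite divff ?mul1r// expf_neq0.
rewrite !h -[in alpha ^+ n](subnK mn) exprD exprMn invfM.
by field; rewrite !expf_neq0.
Qed.

(** The factor b^-n is split off to make the sum an average over the grid; whether the geometric
    prefactor lies below, at or above 1 then governs the limit. *)
Lemma power_variationE p t n : 0 <= t <= 1 -> 1 <= p ->
  power_variation b f p t n =
  (b%:R * `|alpha| `^ p) ^+ n * (b%:R ^- n *
   \sum_(0 <= k < minn (Num.truncn (t * b%:R ^+ n)).+1 (b ^ n))
      `|zsum (alpha * b%:R) n k| `^ p).
Proof.
move=> /andP[t0 t1] p1.
have p0 : p != 0 by rewrite gt_eqF// (lt_le_trans ltr01).
rewrite mulrA exprMn [_ * _ / _]mulrAC divff ?mul1r; last by rewrite expf_neq0.
(* Indices k >= b^n arise only for t = 1; [extend1] sends both of their points to 1, and 0^p = 0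
   because p is nonzero. *)
pose N := minn (Num.truncn (t * b%:R ^+ n)).+1 (b ^ n).
rewrite mulr_sumr /power_variation (big_cat_nat (n := N))//= /N; last first.
  by rewrite geq_minl.
have grid k : (k <= b ^ n)%N -> Num.min (k%:R * b%:R ^- n) 1 = k%:R * b%:R ^- n :> R.
  by move=> kb; rewrite min_l// ler_pdivrMr// mul1r -natrX ler_nat.
have grid1 k : (b ^ n <= k)%N -> Num.min (k%:R * b%:R ^- n) 1 = 1 :> R.
  by move=> kb; rewrite min_r// ler_pdivlMr// mul1r -natrX ler_nat.
rewrite [X in _ + X]big_nat_cond [X in _ + X]big1 ?addr0; last first.
  move=> k; rewrite andbT geq_min => /andP[/orP[h1 h2|h _]].
    by move: (leq_ltn_trans h1 h2); rewrite ltnn.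
  by rewrite /extend1 !grid1 ?(leqW h)// subrr normr0 powR0.
apply: eq_big_nat => k /andP[_]; rewrite leq_min => /andP[_ kb].
rewrite /extend1 !grid ?(ltnW kb)// fractal_increment normrM powRM//.
congr (_ * _); rewrite normrX -powR_mulrn// -powRrM mulrC powRrM.
by rewrite powR_mulrn ?powR_ge0.
Qed.

(** The m-th term of the series has Lipschitz constant L |alpha b|^m; these constants are summable,
    and the bound passes to the limit. *)
Lemma fractal_lipschitz_small : `|alpha * b%:R| < 1 ->
  forall x y, `|f x - f y| <= L / (1 - `|alpha * b%:R|) * `|x - y|.
Proof.
move=> c1 x y.
have [cx _] := psum_cvg x; have [cy _] := psum_cvg y.
have cd : (`|psum n x - psum n y| @[n --> \oo]) --> `|f x - f y|.
  by apply: cvg_norm; exact: cvgB.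
rewrite -(cvg_lim _ cd)//; apply: limr_le; first by apply/cvg_ex; eexists; exact: cd.
exists 0%N => // n _ /=; rewrite /psum -sumrB.
have h k : `|alpha ^+ k * phi (b%:R ^+ k * x) - alpha ^+ k * phi (b%:R ^+ k * y)|
    <= L * `|x - y| * `|alpha * b%:R| ^+ k.
  rewrite -mulrBr normrM normrX normrM exprMn [leRHS]mulrCA ler_wpM2l ?exprn_ge0//.
  rewrite (le_trans (phiL _ _))// -mulrBr normrM normrX.
  by rewrite mulrA mulrAC.
have := @geometric_sum_tail _ _ `|alpha * b%:R| _ _ h 0%N n (leq0n n).
rewrite expr0 mulr1 normr_ge0 c1 => /(_ isT) /le_trans; apply.
by rewrite mulrAC.
Qed.

Lemma fractal_uniformly_continuous (e : R) : 0 < e ->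
  exists2 d : R, 0 < d & forall x y, `|x - y| < d -> `|f x - f y| < e.
Proof.
move=> e0.
have : (L / (1 - `|alpha|) * `|alpha| ^+ m @[m --> \oo]) --> (0 : R).
  by apply: cvg_geometric0; rewrite normr_id.
move=> /cvgrPdist_lt /(_ (e / 3)); rewrite divr_gt0// => /(_ isT) [N _ /(_ N (leqnn N))/=].
rewrite sub0r normrN => /(le_lt_trans (ler_norm _)) tailN.
pose M := \sum_(0 <= m < N) `|alpha| ^+ m * (L * b%:R ^+ m).
have M0 : 0 <= M.
  by apply: sumr_ge0 => m _; rewrite !mulr_ge0 ?exprn_ge0.
(* [M] is a Lipschitz constant of the [N]-th partial sum; it may be 0, whence M + 1. The two tails
   cost e/3 each. *)
exists (e / 3 / (M + 1)); first by rewrite !divr_gt0// ltr_wpDl.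
move=> x y; rewrite ltr_pdivlMr ?ltr_wpDl// => xy.
have psumN : `|psum N x - psum N y| <= M * `|x - y|.
  rewrite /psum -sumrB mulr_suml (le_trans (ler_norm_sum _ _ _))//.
  apply: ler_sum => m _; rewrite -mulrBr normrM normrX -!mulrA ler_wpM2l ?exprn_ge0//.
  by rewrite (le_trans (phiL _ _))// -mulrBr normrM normrX ger0_norm.
have [_ /(_ N) tx] := psum_cvg x; have [_ /(_ N) ty] := psum_cvg y.
rewrite (le_lt_trans (ler_distD (psum N x) _ _))//.
have := ler_distD (psum N y) (psum N x) (f y).
rewrite (distrC (psum N y)) => h.
by have := normr_ge0 (x - y); nra.
Qed.

(** Adding up consecutive increments gives the Lipschitz bound between points of one grid; uniform
    continuity carries it to all points by rounding down to a fine grid. *)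
Lemma fractal_lipschitz K :
  (forall n k, `|alpha ^+ n * zsum (alpha * b%:R) n k| <= K * b%:R ^- n) ->
  forall x y, 0 <= x -> 0 <= y -> `|f x - f y| <= K * `|x - y|.
Proof.
move=> hK.
have K0 : 0 <= K by have := le_trans (normr_ge0 _) (hK 0%N 0%N); rewrite expr0 invr1 mulr1.
have grid n k j : `|f ((k + j)%:R * b%:R ^- n) - f (k%:R * b%:R ^- n)| <=
    K * (j%:R * b%:R ^- n).
  elim: j => [|j ih]; first by rewrite addn0 subrr normr0 mul0r mulr0.
  rewrite (le_trans (ler_distD (f ((k + j)%:R * b%:R ^- n)) _ _))//.
  by rewrite -natr1 mulrDl mulrDr mul1r addrC lerD// addnS fractal_increment.
move=> x y; wlog xy : x y / y <= x => [hw x0 y0|x0 y0].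
  case: (leP y x) => [yx|/ltW xy]; first exact: hw.
  by rewrite distrC (distrC x) hw.
rewrite (ger0_norm (x := x - y)) ?subr_ge0//; apply/ler_addgt0Pr => e e0.
have [|d d0 fd] := @fractal_uniformly_continuous (e / 3); first by rewrite divr_gt0.
(* The factor K + 1 makes one mesh size [h] serve twice: K h < e/3 and h < d. *)
have : ((K + 1) * (b%:R^-1) ^+ m @[m --> \oo]) --> (0 : R).
  by apply: cvg_geometric0; rewrite gtr0_norm ?invr_gt0// invf_lt1// ltr1n.
move=> /cvgrPdist_lt /(_ (Num.min (e / 3) d)).
rewrite lt_min d0 divr_gt0// => /(_ isT) [n _ /(_ n (leqnn n))/=].
rewrite sub0r normrN exprVn => /(le_lt_trans (ler_norm _)).
set h := b%:R ^- n; have h0 : 0 < h by rewrite invr_gt0.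
rewrite lt_min => /andP[Ke Kd].
have trunc_grid z : 0 <= z -> exists k : nat,
    k = Num.truncn (z * b%:R ^+ n) /\ 0 <= z - k%:R * h < h.
  move=> z0; exists (Num.truncn (z * b%:R ^+ n)); split=> //.
  rewrite subr_ge0 ltrBlDr -[X in _ < X + _]mul1r.
  have /andP[h1 h2] := truncn_itv (mulr_ge0 z0 (ltW (bn_gt0 n))).
  by rewrite ler_pdivrMr// h1 -mulrDl nat1r ltr_pdivlMr.
have [k [kE /andP[k1 k2]]] := trunc_grid x x0.
have [l [lE /andP[l1 l2]]] := trunc_grid y y0.
have lk : (l <= k)%N by rewrite kE lE le_truncn// ler_wpM2r// ltW.
have hd : h < d by nra.
have fx : `|f x - f (k%:R * h)| < e / 3 by apply: fd; rewrite ger0_norm// (lt_trans k2).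
have fy : `|f y - f (l%:R * h)| < e / 3 by apply: fd; rewrite ger0_norm// (lt_trans l2).
have := grid n l (k - l)%N; rewrite subnKC// natrB// -/h mulrBl => fkl.
have t1 := ler_distD (f (k%:R * h)) (f x) (f y).
have t2 := ler_distD (f (l%:R * h)) (f (k%:R * h)) (f y).
rewrite (distrC (f (l%:R * h))) in t2.
have : K * (k%:R * h - l%:R * h) <= K * (x - y + h) by rewrite ler_wpM2l//; lra.
by nra.
Qed.

End fractal.

End self_affine.

(** * Averages of periodic and nearly periodic arrays *)

Section averages.
Context {R : realType}.

Lemma sum_periodic (g : nat -> R) (B q : nat) : (forall k, g (k %% B)%N = g k) ->
  \sum_(0 <= k < q * B) g k = q%:R * \sum_(0 <= k < B) g k.
Proof.
move=> gB; elim: q => [|q ih]; first by rewrite mul0n big_geq// mul0r.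
rewrite mulSn addnC (big_cat_nat (n := (q * B)%N)) ?leq_addr//= ih.
have -> : \sum_(q * B <= i < q * B + B) g i = \sum_(0 <= i < B) g (i + q * B)%N.
  by rewrite -{1}[(q * B)%N]add0n big_addn addKn.
rewrite -natr1 mulrDl mul1r; congr (_ + _); apply: eq_big_nat => i _.
by rewrite -gB addnC modnMDl gB.
Qed.

(** Whole periods match exactly. What remains is a sum over an incomplete period and its
    proportional share of a full one, both in [0, G B]. *)
Lemma average_periodic (g : nat -> R) (B N : nat) (G : R) : (0 < B)%N ->
  (forall k, g (k %% B)%N = g k) -> (forall k, 0 <= g k <= G) ->
  `|\sum_(0 <= k < N) g k - N%:R / B%:R * \sum_(0 <= k < B) g k| <= G * B%:R.
Proof.
move=> B0 gB g0G.
have G0 : 0 <= G by have /andP[] := g0G 0%N; exact: le_trans.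
have BR0 : 0 < B%:R :> R by rewrite ltr0n.
have S0 : 0 <= \sum_(0 <= k < B) g k <= G * B%:R.
  rewrite sumr_ge0 => [|i _]; last by case/andP: (g0G i).
  rewrite -[B in leRHS]subn0 mulr_natr -sumr_const_nat ler_sum// => i _.
  by case/andP: (g0G i).
have sB : (N %% B <= B)%N by rewrite ltnW// ltn_mod.
have s0 : 0 <= (N %% B)%:R / (B%:R : R) <= 1.
  by rewrite divr_ge0// ler_pdivrMr// mul1r ler_nat.
rewrite {1 2}(divn_eq N B) (big_cat_nat (n := (N %/ B * B)%N)) ?leq_addr//=.
rewrite sum_periodic// natrD natrM [in X in _ - X]mulrDl mulfK ?gt_eqF//.
have -> : \sum_(N %/ B * B <= i < N %/ B * B + N %% B) g i =
          \sum_(0 <= i < N %% B) g (i + N %/ B * B)%N.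
  by rewrite -{1}[(N %/ B * B)%N]add0n big_addn addKn.
set s := (N %% B)%N in sB s0 *; set S := \sum_(0 <= k < B) g k in S0 *.
set T := \sum_(0 <= i < s) _.
have T0 : 0 <= T <= G * B%:R.
  rewrite sumr_ge0 => [|i _]; last by case/andP: (g0G (i + N %/ B * B)%N).
  rewrite (@le_trans _ _ (\sum_(0 <= i < s) G))//.
    by rewrite ler_sum// => i _; case/andP: (g0G (i + N %/ B * B)%N).
  by rewrite sumr_const_nat subn0 -[G *+ s]mulr_natr ler_wpM2l// ler_nat.
have U0 : 0 <= s%:R / B%:R * S <= G * B%:R.
  case/andP: s0 => s0 s1; case/andP: S0 => S0 S1.
  by rewrite mulr_ge0//= (le_trans _ S1)// ler_piMl.
rewrite mulrDl opprD addrACA subrr add0r ler_norml.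
by case/andP: T0 => T0 T1; case/andP: U0 => U0 U1; lra.
Qed.

(* The rows [g m] are [b ^ m]-periodic and approximate every later row uniformly
   up to [e m]; freezing the row [m] reduces the average to a periodic one. *)
Lemma cvg_average (b : nat) (g : nat -> nat -> R) (e : R^nat) (N : nat -> nat)
    (t G E : R) : (2 <= b)%N ->
  (forall m k, g m (k %% b ^ m)%N = g m k) ->
  (forall m k, 0 <= g m k <= G) ->
  (forall m n k, (m <= n)%N -> `|g n k - g m k| <= e m) ->
  e @ \oo --> (0 : R) ->
  (forall n, (N n <= b ^ n)%N) ->
  ((N n)%:R * b%:R ^- n @[n --> \oo]) --> t ->
  (forall m, `|E - b%:R ^- m * \sum_(0 <= k < b ^ m) g m k| <= e m) ->
  (b%:R ^- n * \sum_(0 <= k < N n) g n k @[n --> \oo]) --> t * E.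
Proof.
move=> hb gper gG ge e0 Nb Nt hE.
have b0 n : 0 < b%:R ^+ n :> R by rewrite exprn_gt0// ltr0n (leq_trans _ hb).
have G0 : 0 <= G by have /andP[] := gG 0%N 0%N; exact: le_trans.
apply/cvgrPdist_lt => eps eps0.
(* One row [m] pays for two errors: e m from freezing the row and |t| e m from replacing its average
   by [E], together below eps/4. *)
have /cvgrPdist_lt /(_ (eps / (4 * (1 + `|t|)))) := e0.
have t1 : 0 < 1 + `|t| by rewrite ltr_pwDl.
rewrite divr_gt0 ?mulr_gt0// => /(_ isT) [m _ /(_ m (leqnn m))/=].
rewrite sub0r normrN => /(le_lt_trans (ler_norm _)).
rewrite ltr_pdivlMr ?mulr_gt0// => em.
have em0 : 0 <= e m by rewrite (le_trans (normr_ge0 _) (hE m)).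
have /cvgrPdist_lt /(_ (eps / (4 * (G + 1)))) := Nt.
rewrite divr_gt0 ?mulr_gt0 ?ltr_wpDl// => /(_ isT) hN.
have : ((G * (b ^ m)%:R) * (b%:R^-1) ^+ n @[n --> \oo]) --> (0 : R).
  apply: cvg_geometric0.
  by rewrite gtr0_norm ?invr_gt0 ?invf_lt1 ?ltr1n ?ltr0n// (leq_trans _ hb).
move=> /cvgrPdist_lt /(_ (eps / 4)); rewrite divr_gt0// => /(_ isT) hB.
near=> n.
have mn : (m <= n)%N by near: n; exists m.
have : `|0 - G * (b ^ m)%:R * (b%:R^-1) ^+ n| < eps / 4 by near: n.
rewrite sub0r normrN exprVn => /(le_lt_trans (ler_norm _)) Bn.
have : `|t - (N n)%:R * b%:R ^- n| < eps / (4 * (G + 1)) by near: n.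
set tn := _ * b%:R ^- n; rewrite ltr_pdivlMr ?mulr_gt0 ?ltr_wpDl// => Nn.
set I := b%:R ^- m * \sum_(0 <= k < b ^ m) g m k.
have I0 : 0 <= I <= G.
  rewrite /I mulr_ge0 ?invr_ge0 ?(ltW (b0 _))//=; last first.
    by apply: sumr_ge0 => k _; case/andP: (gG m k).
  rewrite mulrC ler_pdivrMr// -natrX mulr_natr -[X in _ *+ X]subn0 -sumr_const_nat.
  by apply: ler_sum => k _; case/andP: (gG m k).
(* The chain to t E: freeze row [m] ([step1]), use its periodicity ([step2]), replace [tn] by [t]
   ([step4]), then [I] by [E] ([step5]). *)
have step1 : `|b%:R ^- n * \sum_(0 <= k < N n) g n k
             - b%:R ^- n * \sum_(0 <= k < N n) g m k| <= e m.
  rewrite -mulrBr -sumrB normrM gtr0_norm ?invr_gt0// mulrC ler_pdivrMr//.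
  rewrite (le_trans (ler_norm_sum _ _ _))//.
  rewrite (@le_trans _ _ (\sum_(0 <= k < N n) e m))//.
    by apply: ler_sum => k _; exact: ge.
  by rewrite sumr_const_nat subn0 -[_ *+ N n]mulr_natr ler_wpM2l// -natrX ler_nat.
have step2 : `|b%:R ^- n * \sum_(0 <= k < N n) g m k - tn * I| < eps / 4.
  apply: le_lt_trans Bn.
  have := average_periodic (N n) (_ : 0 < b ^ m)%N (gper m) (gG m).
  rewrite expn_gt0 (leq_trans _ hb)// => /(_ isT) h.
  have -> : tn * I = b%:R ^- n * ((N n)%:R / (b ^ m)%:R * \sum_(0 <= k < b ^ m) g m k).
    by rewrite /tn /I natrX; ring.
  by rewrite -mulrBr normrM gtr0_norm ?invr_gt0// mulrC ler_wpM2r ?invr_ge0 ?(ltW (b0 _)).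
have := hE m; rewrite -/I => step3.
have step4 : `|tn * I - t * I| <= `|t - tn| * G.
  by rewrite -mulrBl normrM distrC ler_wpM2l// ger0_norm; case/andP: I0.
have step5 : `|t * I - t * E| <= `|t| * e m.
  by rewrite -mulrBr normrM ler_wpM2l// distrC.
set A1 := b%:R ^- n * _ in step1 *; set A2 := b%:R ^- n * _ in step1 step2.
have h1 := ler_distD A2 A1 (t * E); have h2 := ler_distD (tn * I) A2 (t * E).
have h3 := ler_distD (t * I) (tn * I) (t * E).
have h4 : `|t - tn| * G <= eps / 4 by have := normr_ge0 (t - tn); nra.
rewrite distrC; nra.
Unshelve. all: by end_near. Qed.

(** The count lies between t b^n and t b^n + 1; capping it at b^n keeps the lower bound because t <=
    1. *)
Lemma cvg_truncn_average (b : nat) (t : R) : (2 <= b)%N -> 0 <= t <= 1 ->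
  ((minn (Num.truncn (t * b%:R ^+ n)).+1 (b ^ n))%:R * b%:R ^- n @[n --> \oo]) --> t.
Proof.
move=> hb /andP[t0 t1].
have b0 n : 0 < b%:R ^+ n :> R by rewrite exprn_gt0// ltr0n (leq_trans _ hb).
have h0 : (1 * (b%:R^-1) ^+ n @[n --> \oo]) --> (0 : R).
  apply: cvg_geometric0.
  by rewrite gtr0_norm ?invr_gt0 ?invf_lt1 ?ltr1n ?ltr0n// (leq_trans _ hb).
have h1 : (t + 1 * (b%:R^-1) ^+ n @[n --> \oo]) --> t.
  by rewrite -[X in _ --> X]addr0; apply: cvgD => //; exact: cvg_cst.
apply: (squeeze_cvgr _ (cvg_cst t) h1); near=> n.
have /andP[l u] := truncn_itv (mulr_ge0 t0 (ltW (b0 n))).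
rewrite ler_pdivlMr// ler_pdivrMr// mul1r exprVn mulrDl mulVf ?gt_eqF//.
apply/andP; split.
  rewrite /minn; case: ifP => _; first exact: ltW.
  by rewrite natrX ler_piMl// ltW.
rewrite (@le_trans _ _ (Num.truncn (t * b%:R ^+ n)).+1%:R) ?ler_nat ?geq_minl//.
by rewrite -natr1 lerD2r.
Unshelve. all: by end_near. Qed.

End averages.

(** * The law of the random integer R_m *)

Section digits.
Context {R : realType} {d : measure_display} {Omega : measurableType d}.
Variables (P : probability Omega R) (b : nat) (U : nat -> {RV P >-> nat}).
Hypothesis hb : (2 <= b)%N.
Hypothesis U_indep : mutually_independent U.
Hypothesis U_unif : forall i, uniform_digit b (U i).

Let b_gt0 : (0 < b)%N. Proof. exact: leq_trans hb. Qed.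

Lemma sum_digits r m : (\sum_(0 <= i < m) (r %/ b ^ i %% b) * b ^ i = r %% b ^ m)%N.
Proof.
elim: m => [|m ih]; first by rewrite big_geq// modn1.
rewrite big_nat_recr//= ih modn_divl -expnS addnC.
by rewrite [RHS](divn_eq _ (b ^ m)) modn_dvdm// expnS dvdn_mull.
Qed.

(** Digits from position [m] on contribute multiples of b^m. Hence b^m-periodic functions take the
    same value at R_m and at every later R_n. *)
Lemma Rproc_modn m n w : (m <= n)%N ->
  (Rproc b U n w %% b ^ m = Rproc b U m w %% b ^ m)%N.
Proof.
move=> mn; rewrite /Rproc (big_cat_nat (n := m))//= addnC.
have /dvdnP[q ->] : (b ^ m %| \sum_(m <= i < n) U i w * b ^ i)%N.
  rewrite big_nat_cond; apply: dvdn_sum => i; rewrite andbT => /andP[mi _].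
  by rewrite dvdn_mull// dvdn_exp2l.
by rewrite modnMDl.
Qed.

Lemma measurable_Rproc m : measurable_fun setT (Rproc b U m).
Proof.
elim: m => [|m ih].
  rewrite (_ : Rproc b U 0 = cst 0%N); first exact: measurable_cst.
  by apply/funext => w; rewrite /Rproc big_geq.
rewrite (_ : Rproc b U m.+1 = fun w => (Rproc b U m w + U m w * b ^ m)%N); last first.
  by apply/funext => w; rewrite /Rproc big_nat_recr.
apply: measurable_fun_addn => //.
by apply: (@measurableT_comp _ _ _ _ _ _ (fun k => k * b ^ m)%N).
Qed.

Let measurable_level m r : measurable (Rproc b U m @^-1` [set r]).
Proof. by rewrite -[X in measurable X]setTI; exact: measurable_Rproc. Qed.

(** By independence the first [m] variables equal the base-b digits of [r] with probability b^-m,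
    and then R_m = r. The variables are [nat]-valued, so on a null set other values may also produce
    [r]; the inclusion yields an inequality. *)
Lemma probability_Rproc_ge m r : (r < b ^ m)%N ->
  ((b%:R ^- m)%:E <= P (Rproc b U m @^-1` [set r]))%E.
Proof.
move=> rb; pose J := [fset i | i in iota 0 m]%fset.
pose A i := [set (r %/ b ^ i %% b)%N].
have mA i : i \in J -> measurable (A i) by [].
have := U_indep mA.
rewrite (eq_bigr (fun=> (b%:R^-1)%:E)) => [|i _]; last first.
  by apply: U_unif; rewrite ltn_mod.
rewrite prodEFin big_const_seq count_predT iter_mulr_1 exprVn.
have -> : size J = m.
  by have := card_fseq (iota 0 m); rewrite undup_id ?iota_uniq// size_iota.
move=> <-; apply: le_measure; rewrite ?inE//.
  apply: fin_bigcap_measurable => // i _.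
  by rewrite -[X in measurable X]setTI; exact: measurable_funPT.
move=> w /= hw; rewrite /Rproc -[RHS](modn_small rb) -sum_digits.
apply: eq_big_nat => i /andP[_ im]; rewrite (hw i)//=.
by rewrite in_fset/= mem_iota.
Qed.

Lemma integral_Rproc_ge m (g : nat -> R) : (forall k, 0 <= g k) ->
  ((b%:R ^- m * \sum_(0 <= r < b ^ m) g r)%:E <= \int[P]_w (g (Rproc b U m w))%:E)%E.
Proof.
move=> g0; rewrite big_mkord mulr_sumr -sumEFin.
have mg : measurable_fun setT (EFin \o (g \o Rproc b U m)).
  apply/measurable_EFinP; apply: (@measurableT_comp _ _ _ _ _ _ g) => //.
  exact: measurable_Rproc.
(* The integrand dominates its restriction to the levels r < b^m, a finite sum of multiples of
   indicators. *)
pose h (r : 'I_(b ^ m)) w := (g r * \1_(Rproc b U m @^-1` [set (r : nat)]) w)%:E.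
have mh r : measurable_fun setT (h r).
  by apply/measurable_EFinP; apply: measurable_funM => //; exact: measurable_indic.
have h0 r w : (0 <= h r w)%E by rewrite lee_fin mulr_ge0.
apply: (@le_trans _ _ (\int[P]_w (\sum_(r < b ^ m) h r w))%E).
  rewrite ge0_integral_sum//; apply: lee_sum => r _.
  rewrite (@integralZl_indic _ _ _ _ _ _
    (fun=> Rproc b U m @^-1` [set (r : nat)]))//; last first.
    by move=> gr; have := g0 r; rewrite leNgt gr.
  rewrite integral_indic// setIT mulrC EFinM; apply: lee_wpmul2l.
    by rewrite lee_fin.
  exact: probability_Rproc_ge.
apply: ge0_le_integral => //.
- by move=> w _; exact: sume_ge0.
- exact: emeasurable_sum.

move=> w _; rewrite sumEFin lee_fin.
have [Rb|Rb] := ltnP (Rproc b U m w) (b ^ m).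
  rewrite (bigD1 (Ordinal Rb))//= big1 ?addr0.
    by rewrite indicE mem_set// mulr1.
  move=> i iR; rewrite indicE memNset ?mulr0//= => /esym iE.
  by case/negP: iR; apply/eqP/val_inj.
rewrite big1 ?g0// => i _; rewrite indicE memNset ?mulr0//= => iE.
by have := ltn_ord i; rewrite -iE ltnNge Rb.
Qed.

Lemma integrable_bounded (X : Omega -> R) (G : R) : measurable_fun setT X ->
  (forall w, `|X w| <= G) -> P.-integrable setT (EFin \o X).
Proof.
move=> mX XG; apply: measurable_bounded_integrable => //.
  by rewrite (le_lt_trans (probability_le1 P _))// ltry.
exists G; split; first exact: num_real.
by move=> M GM w _ /=; rewrite (le_trans (XG w))// ltW.
Qed.

(* The lower bound, applied to [g] and to [G - g], forces equality. *)
Lemma Rintegral_Rproc m (g : nat -> R) (G : R) : (forall k, 0 <= g k <= G) ->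
  (\int[P]_w g (Rproc b U m w) = b%:R ^- m * \sum_(0 <= r < b ^ m) g r)%R.
Proof.
move=> gG.
have G0 : 0 <= G by have /andP[] := gG 0%N; exact: le_trans.
have mg (h : nat -> R) : measurable_fun setT (fun w => h (Rproc b U m w)).
  by apply: (@measurableT_comp _ _ _ _ _ _ h) => //; exact: measurable_Rproc.
have ig (h : nat -> R) : (forall k, 0 <= h k <= G) ->
    P.-integrable setT (EFin \o (fun w => h (Rproc b U m w))).
  move=> hG; apply: (@integrable_bounded _ G) => // w.
  by have /andP[h0 h1] := hG (Rproc b U m w); rewrite ger0_norm.
have lower (h : nat -> R) : (forall k, 0 <= h k <= G) ->
    b%:R ^- m * \sum_(0 <= r < b ^ m) h r <= \int[P]_w h (Rproc b U m w).
  move=> hG; rewrite -lee_fin /Rintegral fineK; last exact/integrable_fin_num/ig.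
  by apply: integral_Rproc_ge => k; case/andP: (hG k).
apply/le_anti; rewrite lower// andbT.
have gG' k : 0 <= G - g k <= G.
  by have /andP[g0 g1] := gG k; rewrite subr_ge0 g1 gerBl.
have := lower (fun k => G - g k) gG'.
rewrite (@RintegralB _ _ _ P setT (cst G))//; last 2 first.
  by apply: (@integrable_bounded _ G) => // w; rewrite ger0_norm.
  exact: ig.
rewrite Rintegral_cst// (_ : fine (P setT) = 1) ?mulr1;
  last by rewrite [P _](probability_setT P).
rewrite sumrB sumr_const_nat subn0 mulrBr.
rewrite -[G *+ _]mulr_natr natrX mulrCA mulVf ?mulr1 ?expf_neq0 ?pnatr_eq0 -?lt0n//.
by rewrite lerD2l lerN2.
Qed.

End digits.

(** * The limit Z, its moments, and the case Z = 0 almost surely *)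

Section limit_variable.
Context {R : realType} {d : measure_display} {Omega : measurableType d}.
Variables (P : probability Omega R) (b : nat) (U : nat -> {RV P >-> nat}).
Variables (phi : R -> R) (L alpha : R).
Hypothesis hb : (2 <= b)%N.
Hypothesis U_indep : mutually_independent U.
Hypothesis U_unif : forall i, uniform_digit b (U i).
Hypothesis phiL : forall x y, `|phi x - phi y| <= L * `|x - y|.
Hypothesis phi_per : periodic phi 1.

Let c := alpha * b%:R.
Hypothesis c_gt1 : 1 < `|c|.

Let T := L / (1 - `|c|^-1).
Let rho := `|c|^-1.
Let Z := Zvar b alpha phi U.

Let b_neq0 : b%:R != 0 :> R. Proof. by rewrite pnatr_eq0 -lt0n (leq_trans _ hb). Qed.
Let rho_ge0 : 0 <= rho. Proof. by rewrite invr_ge0. Qed.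
Let rho_lt1 : rho < 1. Proof. by rewrite invf_lt1// (lt_trans ltr01). Qed.
Let T_ge0 : 0 <= T.
Proof. exact: le_trans (normr_ge0 _) (zsum_bounded hb phiL 0 0 c_gt1). Qed.

(** Since z_m is b^m-periodic, z_m(R_m) = z_m(R_n) for m <= n. So the partial sums of Z are the
    z_n(R_n), and the uniform tail bound applies along the path. *)
Lemma Zvar_approx m w : `|Z w - zsum b phi c m (Rproc b U m w)| <= T * rho ^+ m.
Proof.
pose u n := zsum b phi c n (Rproc b U n w).
have zsumR i n : (i <= n)%N -> zsum b phi c i (Rproc b U i w) = zsum b phi c i (Rproc b U n w).
  move=> iLn; rewrite -(zsum_modn hb phi_per c _ (leqnn i)) -(Rproc_modn _ _ _ iLn).
  by rewrite (zsum_modn hb phi_per).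
have [||cu h] := @cvg_bound_tail _ u (fun m => T * rho ^+ m).
- by move=> i n iLn; rewrite /u (zsumR _ _ iLn); exact: zsum_tail.
- by apply: cvg_geometric0; rewrite ger0_norm.
suff -> : Z w = limn u by exact: h.
(* Partial sums of the series stop before [n], whereas [u n] includes the term [n]; hence the shift
   by one. *)
apply: cvg_lim => //; rewrite -cvg_shiftS.
rewrite (_ : [sequence _]_n = u)//; apply/funext => n.
apply: eq_big_nat => i; rewrite ltnS => /andP[_ iLn]; congr (_ * _).
rewrite /Yproc -(slope_modn hb phi_per _ (leqnn i)) -(Rproc_modn _ _ _ iLn).
by rewrite (slope_modn hb phi_per).
Qed.

Lemma measurable_Zvar : measurable_fun setT Z.
Proof.
apply: (@measurable_fun_cvg _ _ _ _ (fun m w => zsum b phi c m (Rproc b U m w))).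
  move=> m; apply: (@measurableT_comp _ _ _ _ _ _ (zsum b phi c m)) => //.
  exact: measurable_Rproc.
move=> w _; apply/cvgrPdist_le => e e0.
have : (T * rho ^+ m @[m --> \oo]) --> (0 : R).
  by apply: cvg_geometric0; rewrite ger0_norm.
move=> /cvgrPdist_le /(_ _ e0); apply: filterS => m.
rewrite sub0r normrN => h; rewrite (le_trans (Zvar_approx m w))//.
exact: le_trans (ler_norm _) h.
Qed.

Lemma Zvar_bounded w : `|Z w| <= T.
Proof.
have := Zvar_approx 0 w.
by rewrite expr0 mulr1 /zsum big_geq// subr0.
Qed.

Section power.
Variable p : R.
Hypothesis p_ge1 : 1 <= p.

Let p_ge0 : 0 <= p. Proof. by rewrite (le_trans ler01). Qed.
Let E := (\int[P]_w (`|Z w| `^ p))%R.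

Let measurable_power : measurable_fun setT (fun w => `|Z w| `^ p).
Proof.
apply: (@measurableT_comp _ _ _ _ _ _ (@powR R ^~ p)) => //.
by apply: measurableT_comp => //; exact: measurable_Zvar.
Qed.

Let powR_le (x : R) : `|x| <= T -> 0 <= `|x| `^ p <= T `^ p.
Proof. by move=> xT; rewrite powR_ge0/= ge0_ler_powR ?nnegrE. Qed.

Let integrable_power : P.-integrable setT (EFin \o (fun w => `|Z w| `^ p)).
Proof.
apply: (@integrable_bounded _ _ _ _ _ (T `^ p)) => // w.
by rewrite ger0_norm ?powR_ge0//; case/andP: (powR_le (Zvar_bounded w)).
Qed.

Lemma expectation_Zvar : ('E_P[fun w => (`|Z w| `^ p)%R])%E = E%:E.
Proof. by rewrite unlock /E /Rintegral fineK//; exact: integrable_fin_num. Qed.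

(** A nonnegative function with zero integral vanishes almost everywhere, and |Z|^p = 0 forces Z =
    0. *)
Lemma expectation_Zvar_gt0 : ~ {ae P, forall w, Z w = 0} -> 0 < E.
Proof.
move=> nZ; rewrite lt_def; apply/andP; split; last first.
  by apply: Rintegral_ge0 => w _; exact: powR_ge0.
apply/eqP => E0; apply: nZ.
have : (\int[P]_w `|(`|Z w| `^ p)%:E|)%E = 0%E.
  rewrite -[RHS]/(0%:E) -E0 /E /Rintegral fineK; last exact: integrable_fin_num.
  by apply: eq_integral => w _; rewrite gee0_abs// lee_fin powR_ge0.
move=> /ae_eq_integral_abs h.
have {h} := h measurableT (proj2 (measurable_EFinP _ _) measurable_power).
apply: filterS => w /(_ Logic.I) [] /powR_eq0_eq0 /eqP.
by rewrite normr_eq0 => /eqP.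
Qed.

Let lip_tail (x y : R) m : `|x| <= T -> `|y| <= T -> `|x - y| <= T * rho ^+ m ->
  `| `|x| `^ p - `|y| `^ p| <= p * T `^ (p - 1) * (T * rho ^+ m).
Proof.
move=> xT yT xy.
rewrite (le_trans (powR_lipschitz p_ge1 (_ : 0 <= `|x| <= T) (_ : 0 <= `|y| <= T)))//
  ?normr_ge0//.
rewrite ler_wpM2l ?mulr_ge0 ?powR_ge0//.
exact: le_trans (ler_dist_dist _ _) xy.
Qed.

(** The general averaging result applies to the rows |z_m(k)|^p. On [0, T] the power is Lipschitz,
    so the geometric error for z_m becomes one for its p-th power. *)
Lemma cvg_average_zsum t : 0 <= t <= 1 ->
  (b%:R ^- n * \sum_(0 <= k < minn (Num.truncn (t * b%:R ^+ n)).+1 (b ^ n))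
      `|zsum b phi c n k| `^ p @[n --> \oo]) --> t * E.
Proof.
move=> t01.
apply: (@cvg_average _ b (fun n k => `|zsum b phi c n k| `^ p)
  (fun m => p * T `^ (p - 1) * (T * rho ^+ m)) _ t (T `^ p)) => //.
- by move=> m k; rewrite (zsum_modn hb phi_per).
- by move=> m k; apply/powR_le/(zsum_bounded hb phiL).
- move=> m n k mn; apply: lip_tail; [exact: zsum_bounded|exact: zsum_bounded|].
  exact: zsum_tail.
- have : (p * T `^ (p - 1) * T * rho ^+ m @[m --> \oo]) --> (0 : R).
    by apply: cvg_geometric0; rewrite ger0_norm.
  by apply: cvg_trans; apply: near_eq_cvg; near=> m; rewrite /= mulrA.
- by move=> n; rewrite geq_minr.
- exact: cvg_truncn_average.
move=> m.
have gG k : 0 <= `|zsum b phi c m k| `^ p <= T `^ p.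
  exact/powR_le/(zsum_bounded hb phiL).
(* The average of row [m] is the expectation of |z_m(R_m)|^p, which a pointwise bound compares with
   that of |Z|^p. *)
rewrite -(Rintegral_Rproc hb U_indep U_unif m gG).
have iR : P.-integrable setT (EFin \o (fun w => `|zsum b phi c m (Rproc b U m w)| `^ p)).
  apply: (@integrable_bounded _ _ _ _ _ (T `^ p)) => [|w].
    apply: (@measurableT_comp _ _ _ _ _ _ (fun k => `|zsum b phi c m k| `^ p)) => //.
    exact: measurable_Rproc.
  by rewrite ger0_norm ?powR_ge0//; case/andP: (gG (Rproc b U m w)).
have mI : measurable_fun setT (fun w =>
    `|Z w| `^ p - `|zsum b phi c m (Rproc b U m w)| `^ p).
  apply: measurable_funB => //.
  apply: (@measurableT_comp _ _ _ _ _ _ (fun k => `|zsum b phi c m k| `^ p)) => //.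
  exact: measurable_Rproc.
have bI w : `| `|Z w| `^ p - `|zsum b phi c m (Rproc b U m w)| `^ p| <=
    p * T `^ (p - 1) * (T * rho ^+ m).
  apply: lip_tail; [exact: Zvar_bounded|exact: zsum_bounded|exact: Zvar_approx].
rewrite -RintegralB// (le_trans (le_normr_Rintegral _ _))//.
  exact: integrable_bounded bI.
rewrite (@le_trans _ _ (\int[P]_w (p * T `^ (p - 1) * (T * rho ^+ m)))%R)//.
  apply: le_Rintegral => //.
  - apply: (@integrable_bounded _ _ _ _ _ (p * T `^ (p - 1) * (T * rho ^+ m))) => [|w].
      exact: measurableT_comp.
    by rewrite normr_id.
  - apply: (@integrable_bounded _ _ _ _ _ (p * T `^ (p - 1) * (T * rho ^+ m))) => // w.
    rewrite ger0_norm//; apply: mulr_ge0; apply: mulr_ge0 => //;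
      [exact: powR_ge0|exact: exprn_ge0].
rewrite Rintegral_cst// (_ : fine (P setT) = 1) ?mulr1//.
by rewrite [P _](probability_setT P).
Unshelve. all: by end_near. Qed.

End power.

Lemma Zvar_eq0_zsum : {ae P, forall w, Z w = 0} ->
  forall n k, `|alpha ^+ n * zsum b phi c n k| <= T * b%:R ^- n.
Proof.
move=> Z0 n k.
suff [w kw Zw] : exists2 w, Rproc b U n w = (k %% b ^ n)%N & Z w = 0.
  have := Zvar_approx n w; rewrite Zw sub0r normrN kw (zsum_modn hb phi_per)//.
  move=> h; rewrite normrM normrX (le_trans (ler_wpM2l (exprn_ge0 _ (normr_ge0 _)) h))//.
  (* Here |alpha| [rho] = 1/b, because |c| = |alpha| b. *)
  rewrite mulrCA ler_wpM2l// -exprMn /rho /c normrM normr_nat invfM mulrA.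
  have a0 : alpha != 0.
    by apply/eqP => a0; move: c_gt1; rewrite /c a0 mul0r normr0 ltr10.
  by rewrite divff ?mul1r ?normr_eq0// exprVn.
(* Without such a [w] the level set of R_n would lie in the exceptional null set, although its
   probability is at least b^-n. *)
apply: contrapT => nw.
have bn : (k %% b ^ n < b ^ n)%N by rewrite ltn_mod expn_gt0 (leq_trans _ hb).
have := probability_Rproc_ge hb U_indep U_unif bn.
rewrite [P _](_ : _ = 0%E);
  first by rewrite lee_fin leNgt invr_gt0 exprn_gt0// lt_def b_neq0/=.
apply: measure_negligible.
  by rewrite -[X in measurable X]setTI; exact: measurable_Rproc.
by apply: negligibleS Z0 => w /= kw Zw; apply: nw; exists w.
Qed.

End limit_variable.

(** * The three regimes |alpha| b < 1, |alpha| b = 1 and |alpha| b > 1 *)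

Theorem theorem2p1 (R : realType) (b : nat) (alpha : R) (phi : R -> R)
    (d : measure_display) (Omega : measurableType d) (P : probability Omega R)
    (U : nat -> {RV P >-> nat})
    (hb : (2 <= b)%N)
    (halpha1 : -1 < alpha < 1) (halpha0 : alpha != 0)
    (phi_lip : lipschitz phi)
    (phi_per : periodic phi 1)
    (phi_int : forall z : int, phi z%:~R = 0)
    (U_indep : mutually_independent U)
    (U_unif : forall i, uniform_digit b (U i)) :
  let f := fractal_fun b alpha phi in
  let Z := Zvar b alpha phi U in
  let q := - log_base `|alpha| b%:R in
  [/\ (* (a) *)
      `|alpha| < b%:R^-1 -> bounded_variation 0 1 f,
      (* (b) *)
      `|alpha| = b%:R^-1 ->
        forall t : R, 0 <= t <= 1 -> forall p : R, 1 < p ->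
          power_variation b f p t @ \oo --> (0 : R)
    & (* (c) *)
      b%:R^-1 < `|alpha| < 1 ->
        (bounded_variation 0 1 f <-> {ae P, forall w, Z w = 0}) /\
        (~ {ae P, forall w, Z w = 0} ->
          forall t p : R, 0 < t <= 1 -> 1 <= p ->
          [/\ q < p -> (power_variation b f p t n)%:E @[n --> \oo] --> 0%E,
              p = q -> (power_variation b f p t n)%:E @[n --> \oo] -->
                         (t%:E * 'E_P[fun w => (`|Z w| `^ q)%R])%E
            & p < q -> (power_variation b f p t n)%:E @[n --> \oo] --> +oo%E])].
Proof.
move=> f Z q.
have [L phiL] : exists L, forall x y, `|phi x - phi y| <= L * `|x - y|.
  (* [lipschitz] asserts the bound for all constants beyond some [M], so M + 1 is admissible. *)
  have [M [_ hM]] := phi_lip; exists (M + 1) => x y.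
  by apply: (hM (M + 1) _ (x, y)) => //; rewrite ltrDl.
have b0 : 0 < b%:R :> R by rewrite ltr0n (leq_trans _ hb).
have b1 : 1 < b%:R :> R by rewrite ltr1n.
have bn0 n : 0 < b%:R ^+ n :> R by rewrite exprn_gt0.
have alpha1 : `|alpha| < 1 by rewrite ltr_norml.
have a0 : 0 < `|alpha| by rewrite normr_gt0.
have L0 : 0 <= L.
  by have := le_trans (normr_ge0 _) (phiL 1 0); rewrite subr0 normr1 mulr1.
have cE : `|alpha * b%:R| = `|alpha| * b%:R by rewrite normrM normr_nat.
have lna : ln `|alpha| < 0 by rewrite ln_lt0// a0.
(* As 0 < |alpha| < 1, comparing powers of |alpha| reverses the comparison of exponents. *)
have powa s s' : (`|alpha| `^ s < `|alpha| `^ s') = (s' < s).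
  by rewrite /powR gt_eqF// ltr_expR ltr_nM2r.
split.
- move=> ab; have c1 : `|alpha * b%:R| < 1 by rewrite cE -ltr_pdivlMr// div1r.
  apply: (@klipschitz_bounded_variation _ 0 1 (L / (1 - `|alpha * b%:R|))) => //.
    by rewrite divr_ge0// subr_ge0 ltW.
  by move=> x y _ _; exact: fractal_lipschitz_small.
- move=> ab t t01 p p1.
  have c1 : `|alpha * b%:R| = 1 by rewrite cE ab mulVf// gt_eqF.
  (* At most b^n terms (L n)^p enter the average, so the sum is at most r^n (L n)^p, with r < 1
     since |alpha|^p < |alpha| = 1/b. *)
  pose r := b%:R * `|alpha| `^ p.
  have r01 : 0 < r < 1.
    rewrite mulr_gt0 ?powR_gt0//= /r -ltr_pdivlMl// mulr1 -ab.
    by rewrite -[ltRHS]powRr1// powa.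
  have p0 : 0 < p by rewrite (lt_trans ltr01).
  have h := cvg_expr_powR_natmul r01 p0 L0.
  apply: (squeeze_cvgr _ (cvg_cst 0) h); near=> n.
  rewrite (power_variationE hb phi_int halpha0)//; last exact: ltW.
  have S0 : 0 <= \sum_(0 <= k < minn (Num.truncn (t * b%:R ^+ n)).+1 (b ^ n))
      `|zsum b phi (alpha * b%:R) n k| `^ p by apply: sumr_ge0 => k _; exact: powR_ge0.
  have /andP[/ltW r0 _] := r01.
  rewrite mulr_ge0 ?exprn_ge0 ?mulr_ge0 ?invr_ge0 ?(ltW (bn0 n))//=.
  rewrite ler_wpM2l ?exprn_ge0// mulrC ler_pdivrMr//.
  apply: (@le_trans _ _ (\sum_(0 <= k < minn (Num.truncn (t * b%:R ^+ n)).+1 (b ^ n))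
      (L * n%:R) `^ p)).
    apply: ler_sum => k _; apply: ge0_ler_powR; rewrite ?nnegrE ?mulr_ge0 ?(ltW p0)//.
    exact: zsum_le_nat.
  rewrite sumr_const_nat subn0 -[_ *+ minn _ _]mulr_natr ler_wpM2l ?powR_ge0//.
  by rewrite -natrX ler_nat geq_minr.
move=> /andP[ab _].
have c1 : 1 < `|alpha * b%:R| by rewrite cE -ltr_pdivrMr// div1r.
(* The exponent q is the one with b |alpha|^q = 1; the prefactor b |alpha|^p is below, at or above 1
   as p > q, p = q or p < q. *)
have aq : `|alpha| `^ q = b%:R^-1.
  rewrite /powR gt_eqF// /q /log_base mulNr divfK ?lt_eqF//.
  by rewrite expRN lnK// posrE.
have q1 : 1 < q by rewrite -powa aq powRr1.
pose T := L / (1 - `|alpha * b%:R|^-1).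
have limS p t : 1 <= p -> 0 <= t <= 1 ->
    exists2 A : R^nat, (A @ \oo --> t * (\int[P]_w (`|Z w| `^ p))%R) &
      forall n, power_variation b f p t n = (b%:R * `|alpha| `^ p) ^+ n * A n.
  move=> p1 t01; eexists.
    exact: (cvg_average_zsum hb U_indep U_unif phiL phi_per c1 p1 t01).
  by move=> n; rewrite (power_variationE hb phi_int halpha0).
(* Divergence below q is needed twice: for the last limit in (c), and with p = t = 1 to exclude
   bounded variation. *)
have limy p t : 1 <= p -> p < q -> 0 < t <= 1 -> ~ {ae P, forall w, Z w = 0} ->
    power_variation b f p t @ \oo --> +oo.
  move=> p1 pq /andP[t0 t1] nZ.
  have [|A Al AE] := limS p t p1; first by rewrite ltW.
  have E0 : 0 < (\int[P]_w (`|Z w| `^ p))%R.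
    exact: (expectation_Zvar_gt0 hb phiL phi_per c1 p1 nZ).
  have tE0 : 0 < t * (\int[P]_w (`|Z w| `^ p))%R by rewrite mulr_gt0.
  have r1 : 1 < b%:R * `|alpha| `^ p by rewrite -ltr_pdivrMl// mulr1 -aq powa.
  (* Half of the positive limit eventually bounds the averages [A n] from below. *)
  have tE20 : 0 < t * (\int[P]_w (`|Z w| `^ p))%R / 2 by rewrite divr_gt0.
  apply: ger_cvgy (cvg_expr_pinfty tE20 r1); near=> n.
  rewrite AE mulrC ler_wpM2l ?exprn_ge0 ?(le_trans ler01 (ltW r1))// ltW//.
  near: n; apply: (cvgr_gt _ Al); rewrite ltr_pdivrMr//; lra.
split.
- split=> [fBV|Z0].
    (* Since 1 < q, a nonzero Z would make the grid sums with p = 1 exceed every bound on the total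
       variation. *)
    apply: contrapT => nZ.
    have [M hM] := fBV.
    have t1 : 0 < (1 : R) <= 1 by rewrite ltr01 lexx.
    have /cvgryPgt /(_ M) [n _ /(_ n (leqnn n))] /= := limy 1 1 (lexx _) q1 t1 nZ.
    by rewrite ltNge grid_variation_le// (leq_trans _ hb).
  apply: (@klipschitz_bounded_variation _ 0 1 T) => //.
    exact: le_trans (normr_ge0 _) (zsum_bounded hb phiL 0 0 c1).
  move=> x y /andP[x0 _] /andP[y0 _].
  apply: (fractal_lipschitz hb phiL phi_int alpha1 halpha0) => //.
  exact: (Zvar_eq0_zsum hb U_indep U_unif phiL phi_per c1 Z0).
move=> nZ t p t01 p1.
have t01' : 0 <= t <= 1 by case/andP: t01 => /ltW -> ->.
have [A Al AE] := limS p t p1 t01'.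
have EE := expectation_Zvar U hb phiL phi_per c1 p1.
split=> pq.
- apply: cvg_EFin_real.
  have r1 : b%:R * `|alpha| `^ p < 1 by rewrite -ltr_pdivlMl// mulr1 -aq powa.
  have r0 : 0 <= b%:R * `|alpha| `^ p by rewrite mulr_ge0// ?powR_ge0// ltW.
  have h : (1 * (b%:R * `|alpha| `^ p) ^+ n @[n --> \oo]) --> (0 : R).
    by apply: cvg_geometric0; rewrite ger0_norm.
  rewrite -[X in _ --> X](mul0r (t * (\int[P]_w (`|Z w| `^ p))%R)).
  rewrite (_ : power_variation b f p t = fun n => 1 * (b%:R * `|alpha| `^ p) ^+ n * A n).
    exact: cvgM.
  by apply/funext => n; rewrite AE mul1r.
- rewrite -pq EE -EFinM; apply: cvg_EFin_real.
  rewrite (_ : power_variation b f p t = A)//; apply/funext => n.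
  by rewrite AE pq aq divff ?gt_eqF// expr1n mul1r.
- by apply/cvgeryP; exact: limy.
Unshelve. all: by end_near. Qed.
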